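(* Let $\mathcal{A} \in \mathbb{C}^{I_1 \times \cdots \times I_N \times I_1 \times \cdots \times I_N}$ be a deterministic positive definite (PD) tensor, let $\mathcal{X} \in \mathbb{C}^{I_1 \times \cdots \times I_N \times I_1 \times \cdots \times I_N}$ be a random Hermitian tensor, and let $p \geq 1$. Then $$\mathrm{Pr}\left(\mathcal{X} \not\preceq \mathcal{A}\right) \leq \mathrm{Tr}\left(\mathbb{E}\left[\left\vert\mathcal{X}\right\vert^p\right]\star_N \mathcal{A}^{-p}\right).$$
   Context: Square tensors in $\mathbb{C}^{I_1 \times \cdots \times I_N \times I_1 \times \cdots \times I_N}$ are multiplied by the Einstein product $(\mathcal{X}\star_N\mathcal{Y})_{i_1,\dots,i_N,k_1,\dots,k_N} = \sum_{j_1,\dots,j_N} x_{i_1,\dots,i_N,j_1,\dots,j_N}\,y_{j_1,\dots,j_N,k_1,\dots,k_N}$. The identity tensor $\mathcal{I}$ has entries $\prod_{k}\delta_{i_k,j_k}$. The conjugate transpose is $(\mathcal{X}^{\mathrm H})_{j_1,\dots,j_N,i_1,\dots,i_N}=\overline{x_{i_1,\dots,i_N,j_1,\dots,j_N}}$, and $\mathcal{X}$ is Hermitian if $\mathcal{X}^{\mathrm H}=\mathcal{X}$. The trace is $\mathrm{Tr}(\mathcal{X})=\sum_{i_1,\dots,i_N}x_{i_1,\dots,i_N,i_1,\dots,i_N}$. (Equivalently, these are square matrices of size $\prod_{j=1}^N I_j$ under unfolding, with the usual matrix product, trace, eigenvalues, etc.) Functions of Hermitian tensors, such as the absolute value $|\mathcal{X}|$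 and real powers, are defined by functional calculus. A Hermitian tensor is PD if all its eigenvalues are positive and semipositive definite (SPD) if all its eigenvalues are nonnegative. $\mathcal{A}\preceq\mathcal{B}$ means $\mathcal{B}-\mathcal{A}$ is SPD, and $\mathcal{A}\not\preceq\mathcal{B}$ means $\mathcal{B}-\mathcal{A}$ is not SPD. Expectations are taken entrywise and are understood to exist. *)

(* Defs.v *)
From mathcomp Require Import all_boot all_order all_algebra spectral.
From mathcomp Require Import complex.
From mathcomp Require Import all_classical all_reals all_analysis.

Set Implicit Arguments.
Unset Strict Implicit.
Unset Printing Implicit Defensive.

Import Order.TTheory GRing.Theory Num.Theory.
Local Open Scope ring_scope.
Local Open Scope complex_scope.

(* Multi-indices (i_1, ..., i_N) with i_k < I_k.  *)
Definition midx (N : nat) (I : 'I_N -> nat) : finType :=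
  {dffun forall k : 'I_N, 'I_(I k)}.

(* C^{I_1 x ... x I_N x I_1 x ... x I_N}; the 2N indices are grouped as a pair
   of multi-indices. *)
Definition tensor (R : realType) (N : nat) (I : 'I_N -> nat) : Type :=
  {ffun midx I * midx I -> R[i]}.

Section Tensor.
Variables (R : realType) (N : nat) (I : 'I_N -> nat).
Implicit Types X Y : tensor R I.

Definition einstein X Y : tensor R I :=
  [ffun ik => \sum_(j : midx I) X (ik.1, j) * Y (j, ik.2)].

Definition tconjt X : tensor R I := [ffun ji => (X (ji.2, ji.1))^*].

Definition thermitian X : Prop := tconjt X = X.

Definition ttrace X : R[i] := \sum_(i : midx I) X (i, i).

Definition teigenvalue X (a : R[i]) : Prop :=
  exists2 v : {ffun midx I -> R[i]}, v != 0 &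
    forall i, \sum_(j : midx I) X (i, j) * v j = a * v i.

(* In R[i], 0 <= a (resp. 0 < a) means that a is real and nonnegative (resp.
   positive). *)
Definition tpd X : Prop :=
  thermitian X /\ forall a, teigenvalue X a -> 0 < a.

Definition tspd X : Prop :=
  thermitian X /\ forall a, teigenvalue X a -> 0 <= a.

Definition tle X Y : Prop := tspd (Y - X).

Definition unfold_tensor X : 'M[R[i]]_#|midx I| :=
  \matrix_(a, b) X (enum_val a, enum_val b).

Definition fold_tensor (M : 'M[R[i]]_#|midx I|) : tensor R I :=
  [ffun ij => M (enum_rank ij.1) (enum_rank ij.2)].

(* f(X) = U^H diag(f(lambda)) U for the unitary diagonalization
   X = U^H diag(lambda) U provided by the library (spectralmx, spectral_diag).
   Here U is unitary, so that invmx U = U^H.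
   Only meaningful for Hermitian X, whose lambda is real; f(X) then does not
   depend on the diagonalization, see tfunE. *)
Definition tfun (f : R -> R) X : tensor R I :=
  let M := unfold_tensor X in
  fold_tensor (invmx (spectralmx M)
    *m diag_mx (map_mx (fun z : R[i] => (f (complex.Re z))%:C)
                       (spectral_diag M))
    *m spectralmx M).

Definition tabs X : tensor R I := tfun (fun x => `|x|) X.

(* powR is the usual real power on positive reals, with 0 `^ p = 0 for p <> 0;
   its value at negative reals is a convention, so tpow is to be used on SPD
   tensors (PD tensors if p < 0). *)
Definition tpow X (p : R) : tensor R I := tfun (fun x => x `^ p) X.

Lemma unfold_tensorK : cancel unfold_tensor fold_tensor.
Proof.
by move=> X; apply/ffunP => -[i j]; rewrite ffunE mxE !enum_rankK.
Qed.

Lemma fold_tensorK : cancel fold_tensor unfold_tensor.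
Proof.
by move=> M; apply/matrixP => a b; rewrite mxE ffunE /= !enum_valK.
Qed.

Lemma thermitian_hermsymmx X : thermitian X -> unfold_tensor X \is hermsymmx.
Proof.
move=> hX; apply/is_hermitianmxP; rewrite expr0 scale1r.
by apply/matrixP => a b; rewrite !mxE -{1}hX ffunE.
Qed.

Lemma tfunE (f : R -> R) X (U : 'M[R[i]]_#|midx I|) (l : 'rV[R[i]]_#|midx I|) :
  thermitian X -> U \in unitmx ->
  unfold_tensor X = invmx U *m diag_mx l *m U ->
  tfun f X = fold_tensor (invmx U
    *m diag_mx (map_mx (fun z : R[i] => (f (complex.Re z))%:C) l) *m U).
Proof.
move=> hX Uu XU; rewrite /tfun; congr fold_tensor.
have /hermitian_normalmx/orthomx_spectralP := thermitian_hermsymmx hX.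
set P := spectralmx _; set D := spectral_diag _ => XP.
have Pu : P \in unitmx by exact: spectral_unit.
pose W := P *m invmx U.
have comm : diag_mx D *m W = W *m diag_mx l.
  have : invmx P *m diag_mx D *m P = invmx U *m diag_mx l *m U by rewrite -XP.
  move/(congr1 (fun Z => P *m Z *m invmx U)).
  by rewrite !mulmxA mulmxV// mul1mx mulmxK// /W mulmxA.
have commf (g : R[i] -> R[i]) :
    diag_mx (map_mx g D) *m W = W *m diag_mx (map_mx g l).
  clearbody W; apply/matrixP => a b; move/matrixP/(_ a b): comm.
  rewrite !mul_diag_mx !mul_mx_diag !mxE.
  have [->|W0] := eqVneq (W a b) 0; first by rewrite !mulr0 !mul0r.
  by rewrite mulrC => /(mulfI W0) ->; rewrite mulrC.
have Wu : W \in unitmx by rewrite unitmx_mul Pu unitmx_inv.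
have UW : U = invmx W *m P.
  by rewrite -[X in invmx W *m X](mulmxKV Uu) -/W mulKmx.
have VUW : invmx U = invmx P *m W by rewrite /W mulKmx.
clearbody W; rewrite VUW [in RHS]UW -!mulmxA; congr (_ *m _).
by rewrite (mulmxA W) -commf -!mulmxA mulKVmx.
Qed.

End Tensor.

Section RandomTensor.
Variables (R : realType) (d : measure_display) (Omega : measurableType d).
Variables (P : probability Omega R) (N : nat) (I : 'I_N -> nat).
Implicit Type X : Omega -> tensor R I.

Definition random_tensor X : Prop := forall i j : midx I,
  measurable_fun setT (fun w => complex.Re (X w (i, j))) /\
  measurable_fun setT (fun w => complex.Im (X w (i, j))).

Definition random_hermitian X : Prop :=
  random_tensor X /\ forall w, thermitian (X w).

Definition has_texpectation X : Prop := forall i j : midx I,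
  P.-integrable setT (fun w => (complex.Re (X w (i, j)))%:E) /\
  P.-integrable setT (fun w => (complex.Im (X w (i, j)))%:E).

(* Meaningful under has_texpectation, where the expectations below are
   finite. *)
Definition texpectation X : tensor R I := [ffun ij =>
  fine 'E_P[fun w => complex.Re (X w (ij.1, ij.2))] +i*
  fine 'E_P[fun w => complex.Im (X w (ij.1, ij.2))]].

End RandomTensor.

(* Main.v *)
(* If Tr(|X|^p A^-p) < 1, then the semipositive definite tensor
   A^(-p/2) |X|^p A^(-p/2) has all its eigenvalues in [0, 1), so that
   |X|^p <= A^p; the Loewner-Heinz inequality then gives X <= |X| <= A.
   Hence the indicator of the event X </= A is at most Tr(|X|^p A^-p), and the
   theorem follows by taking expectations.
   Loewner-Heinz is proved by Pedersen's argument: the set of exponents t with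
   |X|^t <= A^t contains 0 and p and is stable under midpoints, hence is dense
   in [0, p], and it is closed at 1 by continuity.
   The event is measurable because a quadratic form that takes a negative value
   takes one at a vector with Gaussian integer entries, and those are
   countably many. *)

Require Import Defs.
From mathcomp Require Import all_boot all_order all_algebra.
From mathcomp Require Import complex.
From mathcomp Require Import all_classical all_reals all_analysis.
From mathcomp Require Import spectral measurable_realfun ring lra.

Set Implicit Arguments.
Unset Strict Implicit.
Unset Printing Implicit Defensive.

Import Order.TTheory GRing.Theory Num.Theory.
Import numFieldNormedType.Exports.
Local Open Scope classical_set_scope.
Local Open Scope ring_scope.
Local Open Scope complex_scope.
Local Open Scope sesquilinear_scope.

(** * Unitary diagonalization and quadratic forms of complex matrices *)

Section UnitaryDiagonal.
Context {C : numClosedFieldType} {n : nat}.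
Implicit Types (M N U V B : 'M[C]_n) (u v w : 'rV[C]_n) (l m : 'rV[C]_n).

Definition udiag U l : 'M[C]_n := U^t* *m diag_mx l *m U.

Lemma invmx_udiag U l : U \is unitarymx ->
  invmx U *m diag_mx l *m U = udiag U l.
Proof. by move=> Uu; rewrite invmx_unitary. Qed.

Lemma udiag_hermitian U l : l \is a mxOver Num.real ->
  (udiag U l)^t* = udiag U l.
Proof.
move=> lr; rewrite /udiag !trmx_mul !map_mxM trmxCK mulmxA.
rewrite tr_diag_mx map_diag_mx; congr (_ *m diag_mx _ *m _).
by apply/rowP => k; rewrite mxE; apply/CrealP/(mxOverP lr).
Qed.

Lemma udiagM U l m : U \is unitarymx ->
  udiag U l *m udiag U m = udiag U (\row_k (l 0 k * m 0 k)).
Proof.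
move=> Uu; rewrite /udiag !mulmxA mulmxtVK //.
rewrite -(mulmxA _ (diag_mx _) (diag_mx _)).
congr (_ *m _ *m _); rewrite mul_diag_mx; apply/matrixP => i j.
by rewrite !mxE mulrnAr.
Qed.

Lemma udiag1 U : U \is unitarymx -> udiag U (const_mx 1) = 1%:M.
Proof.
move=> Uu; rewrite /udiag diag_const_mx mulmx1.
by rewrite -invmx_unitary // mulVmx // unitarymx_unit.
Qed.

Lemma mxtrace_udiag U l : U \is unitarymx -> \tr (udiag U l) = \sum_k l 0 k.
Proof.
move=> Uu; rewrite /udiag mxtrace_mulC mulmxA (unitarymxP _) // mul1mx.
exact: mxtrace_diag.
Qed.

Lemma row_udiag U l k : U \is unitarymx ->
  row k U *m udiag U l = l 0 k *: row k U.
Proof.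
move=> Uu; rewrite -row_mul /udiag !mulmxA (unitarymxP _) // mul1mx.
by rewrite mul_diag_mx; apply/rowP => j; rewrite !mxE.
Qed.

Lemma row_unitary_neq0 U k : U \is unitarymx -> row k U != 0.
Proof.
move=> Uu; apply/eqP => h.
have : row k (U *m U^t*) = 0 by rewrite row_mul h mul0mx.
rewrite (unitarymxP _) // => /rowP/(_ k); rewrite !mxE eqxx.
by move/eqP; rewrite oner_eq0.
Qed.

Lemma udiag_col U l k : U \is unitarymx ->
  udiag U l *m col k (U^t*) = l 0 k *: col k (U^t*).
Proof.
move=> Uu; rewrite /udiag [in LHS]colE mulmxA mulmxtVK // -colE mul_mx_diag.
by apply/colP => j; rewrite !mxE mulrC.
Qed.

Lemma col_unitary_neq0 U k : U \is unitarymx -> col k (U^t*) != 0.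
Proof.
move=> Uu; apply/eqP => h.
have : col k (U *m U^t*) = 0 by rewrite colE -mulmxA -colE h mulmx0.
rewrite (unitarymxP _) // => /colP/(_ k); rewrite !mxE eqxx.
by move/eqP; rewrite oner_eq0.
Qed.

Lemma hermitian_udiag M : M^t* = M ->
  M = udiag (spectralmx M) (spectral_diag M) /\
  spectral_diag M \is a mxOver Num.real.
Proof.
move=> Mh; have hM : M \is hermsymmx.
  by apply/is_hermitianmxP; rewrite expr0 scale1r.
split; last exact: hermitian_spectral_diag_real.
rewrite {1}(orthomx_spectralP (hermitian_normalmx hM)).
by rewrite invmx_unitary ?spectral_unitarymx.
Qed.

(** Taking the real part makes the form symmetric and its values comparable in the partial order of
    [C]. For Hermitian [M] nothing is lost: [qf M] is the usual quadratic form and [qle] is the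
    Loewner order. *)
Definition rdot u v : C := 'Re ((u *m v^t*) 0 0).

Definition qf M v : C := rdot (v *m M) v.

Definition qle M N := forall v, qf M v <= qf N v.

Lemma qf_real M v : qf M v \is Num.real.
Proof. exact: Creal_Re. Qed.

Lemma rdotDl u v w : rdot (u + v) w = rdot u w + rdot v w.
Proof. by rewrite /rdot mulmxDl mxE raddfD. Qed.

Lemma rdotZl a u v : a \is Num.real -> rdot (a *: u) v = a * rdot u v.
Proof. by move=> ar; rewrite /rdot -scalemxAl mxE ReMl. Qed.

Lemma rdotNl u v : rdot (- u) v = - rdot u v.
Proof. by rewrite /rdot mulNmx mxE raddfN. Qed.

Lemma rdotC u v : rdot u v = rdot v u.
Proof.
rewrite /rdot -Re_conj; congr ('Re _).
rewrite !mxE rmorph_sum; apply: eq_bigr => k _.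
by rewrite !mxE rmorphM /= mulrC; congr (_ * _); exact: conjCK.
Qed.

Lemma rdotvv v : rdot v v = \sum_k `|v 0 k| ^+ 2.
Proof.
rewrite /rdot mxE raddf_sum; apply: eq_bigr => k _.
by rewrite !mxE -normCK; apply/Creal_ReP; rewrite rpredX // normr_real.
Qed.

Lemma rdot_ge0 v : 0 <= rdot v v.
Proof. by rewrite rdotvv sumr_ge0 // => k _; rewrite exprn_ge0. Qed.

Lemma rdot_gt0 v : v != 0 -> 0 < rdot v v.
Proof.
move=> v0; rewrite lt_neqAle rdot_ge0 andbT eq_sym; apply: contra v0.
rewrite rdotvv psumr_eq0 => [/allP h|k _]; last by rewrite exprn_ge0.
apply/eqP/rowP => k; rewrite mxE; apply/eqP.
by have := h k (mem_index_enum _); rewrite /= expf_eq0 /= normr_eq0.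
Qed.

Lemma rdot_mulmx u v B : rdot (u *m B) v = rdot u (v *m B^t*).
Proof. by rewrite /rdot trmx_mul map_mxM trmxCK mulmxA. Qed.

(** Expands the squared norm of [u - v]. It stands in for Cauchy-Schwarz in [loewner_midpoint]. *)
Lemma rdot_le_mean u v : 2 * rdot u v <= rdot u u + rdot v v.
Proof.
rewrite -subr_ge0; have := rdot_ge0 (u - v).
rewrite rdotDl rdotNl (rdotC u) (rdotC v) !rdotDl !rdotNl (rdotC v u).
by congr (0 <= _); ring.
Qed.

Lemma qfD M N v : qf (M + N) v = qf M v + qf N v.
Proof. by rewrite /qf mulmxDr rdotDl. Qed.

Lemma qfN M v : qf (- M) v = - qf M v.
Proof. by rewrite /qf mulmxN rdotNl. Qed.

Lemma qf_conj B M v : qf (B *m M *m B^t*) v = qf M (v *m B).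
Proof. by rewrite /qf !mulmxA rdot_mulmx trmxCK. Qed.

Lemma qf_udiag U l v : l \is a mxOver Num.real ->
  qf (udiag U l) v = \sum_k l 0 k * `|(v *m U^t*) 0 k| ^+ 2.
Proof.
move=> lr; rewrite /qf /udiag !mulmxA rdot_mulmx; set w := v *m _.
rewrite /rdot mxE raddf_sum; apply: eq_bigr => k _; clearbody w.
rewrite mul_mx_diag !mxE mulrAC mulrC -normCK.
by apply/Creal_ReP; rewrite realM ?(mxOverP lr) // rpredX // normr_real.
Qed.

Lemma qle_udiag U l m : l \is a mxOver Num.real -> m \is a mxOver Num.real ->
  (forall k, l 0 k <= m 0 k) -> qle (udiag U l) (udiag U m).
Proof.
move=> lr mr lm v; rewrite !qf_udiag //; apply: ler_sum => k _.
by rewrite ler_wpM2r // exprn_ge0.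
Qed.

(** With [v] the conjugate transpose of [w], the number v M w equals [a] times the positive number
    [rdot v v]. It is real because [M] is Hermitian, so it coincides with [qf M v]. *)
Lemma eigenvalue_ge0 M a (w : 'cV[C]_n) : M^t* = M ->
  (forall v, 0 <= qf M v) -> w != 0 -> M *m w = a *: w -> 0 <= a.
Proof.
move=> Mh Mge0 w0 Mw; pose v := w^t*.
have wv : w = v^t* by rewrite trmxCK.
have v0 : v != 0.
  by apply: contra w0 => /eqP v0; rewrite wv v0 trmx0 map_mx0.
have dv : (v *m w) 0 0 = rdot v v.
  rewrite rdotvv wv mxE; apply: eq_bigr => k _.
  by rewrite normCK ![_^t* k 0]mxE [_^T k 0]mxE.
have vMw : (v *m M *m w) 0 0 = a * rdot v v.
  by rewrite -mulmxA Mw -scalemxAr mxE dv.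
have vMwC : Num.conj ((v *m M *m w) 0 0) = (v *m M *m w) 0 0.
  have E : (v *m M *m w)^t* = v *m M *m w.
    by rewrite trmx_mul map_mxM trmx_mul map_mxM Mh -/v -wv mulmxA.
  by rewrite -[in RHS]E !mxE.
have := Mge0 v; rewrite /qf /rdot -wv.
move/CrealP: vMwC => /Creal_ReP ->.
by rewrite vMw pmulr_lge0 // rdot_gt0.
Qed.

End UnitaryDiagonal.

(** * Loewner-Heinz for abstract families of powers *)

Section LoewnerHeinz.
Context {C : numClosedFieldType} {n : nat} {K : numFieldType}.
Variables S T : K -> 'M[C]_n.
Hypotheses (SH : forall t, (S t)^t* = S t) (TH : forall t, (T t)^t* = T t).
(** [S t] stands for |X|^t, where |X| may be singular, so exponents add only when they are
    nonnegative; [T t] stands for A^t with A positive definite, which forms a group. *)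
Hypothesis SD : forall s t, 0 <= s -> 0 <= t -> S s *m S t = S (s + t).
Hypothesis TD : forall s t, T s *m T t = T (s + t).
Hypothesis T0 : T 0 = 1%:M.

Let TVK t : T t *m T (- t) = 1%:M.
Proof. by rewrite TD subrr T0. Qed.

Let TKV t : T (- t) *m T t = 1%:M.
Proof. by rewrite TD addNr T0. Qed.

(** A congruence of [S t] that turns the comparison with [T t] into a comparison with the identity,
    hence into a bound on eigenvalues. *)
Let Z t := T (- (t / 2)) *m S t *m T (- (t / 2)).

Let ZH t : (Z t)^t* = Z t.
Proof.
by rewrite /Z trmx_mul map_mxM (trmx_mul (T _)) map_mxM !TH SH mulmxA.
Qed.

Let SZ t : S t = T (t / 2) *m Z t *m (T (t / 2))^t*.
Proof. by rewrite TH /Z !mulmxA TVK mul1mx -mulmxA TKV mulmx1. Qed.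

Let qle_of_spectrum t : (forall k, spectral_diag (Z t) 0 k <= 1) ->
  qle (S t) (T t).
Proof.
move=> z1 v; rewrite SZ.
have -> : T t = T (t / 2) *m 1%:M *m (T (t / 2))^t*.
  by rewrite TH mulmx1 TD -splitr.
have [ZE zr] := hermitian_udiag (ZH t).
have Wu := spectral_unitarymx (Z t).
rewrite !qf_conj -(udiag1 Wu) {1}ZE; apply: qle_udiag => // [|k].
  by apply/mxOverP => i j; rewrite mxE real1.
by rewrite mxE.
Qed.

Let Z_ge0 p : 0 <= p -> forall k, 0 <= spectral_diag (Z p) 0 k.
Proof.
move=> p0 k; have p20 : 0 <= p / 2 by rewrite divr_ge0.
have [ZE zr] := hermitian_udiag (ZH p).
have Wu := spectral_unitarymx (Z p).
have wg0 := rdot_gt0 (row_unitary_neq0 k Wu).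
rewrite -(pmulr_lge0 _ wg0) -rdotZl ?(mxOverP zr) // -(row_udiag _ _ Wu) -ZE.
(* A product of a matrix with its own adjoint, so its eigenvalue times [rdot w w], for an eigenrow
   w, is again a squared norm. *)
have -> : Z p = (T (- (p / 2)) *m S (p / 2)) *m (T (- (p / 2)) *m S (p / 2))^t*.
  rewrite trmx_mul map_mxM SH TH !mulmxA -(mulmxA _ (S _) (S _)).
  by rewrite SD // -splitr.
by rewrite mulmxA rdot_mulmx trmxCK rdot_ge0.
Qed.

Let mxtrace_ST p : \tr (S p *m T (- p)) = \sum_k spectral_diag (Z p) 0 k.
Proof.
have [ZE _] := hermitian_udiag (ZH p).
rewrite -(mxtrace_udiag _ (spectral_unitarymx (Z p))) -ZE.
by rewrite /Z [RHS]mxtrace_mulC mulmxA TD -opprD -splitr mxtrace_mulC.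
Qed.

Lemma mxtrace_ST_ge0 p : 0 <= p -> 0 <= \tr (S p *m T (- p)).
Proof. by move=> p0; rewrite mxtrace_ST sumr_ge0 // => k _; exact: Z_ge0. Qed.

(** By cyclicity the trace is the sum of the eigenvalues of [Z p]; as these are nonnegative, each is
    at most the sum. *)
Lemma qle_of_mxtrace p : 0 <= p -> \tr (S p *m T (- p)) < 1 -> qle (S p) (T p).
Proof.
move=> p0 tr1; apply: qle_of_spectrum => k; apply: le_trans (ltW tr1).
rewrite mxtrace_ST (bigD1 k) //= lerDl.
by apply: sumr_ge0 => i _; exact: Z_ge0.
Qed.

(* Pedersen: an eigenvalue [l] of [Z t] yields [w] with
   [w S t = l w T t]; splitting [S t] as [S (s/2) S (r/2)] and bounding each
   factor separately gives [l <= 1]. *)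
Lemma loewner_midpoint r s : 0 <= r -> 0 <= s ->
  qle (S r) (T r) -> qle (S s) (T s) ->
  qle (S ((r + s) / 2)) (T ((r + s) / 2)).
Proof.
move=> r0 s0 ler les; set t := (r + s) / 2; apply: qle_of_spectrum => k.
have [ZE zr] := hermitian_udiag (ZH t).
have Wu := spectral_unitarymx (Z t).
set z := spectral_diag (Z t) in ZE zr *; set W := spectralmx (Z t) in ZE Wu.
pose w := row k W *m T (- (t / 2)).
have wS : w *m S t = z 0 k *: (w *m T t).
  transitivity (row k W *m Z t *m T (t / 2)).
    by rewrite /w /Z !mulmxA -[in RHS]mulmxA TKV mulmx1.
  rewrite [in LHS]ZE row_udiag // -scalemxAl; congr (_ *: _).
  by rewrite /w -mulmxA TD {3}[t]splitr addKr.
(* Chosen so that t + e = s and e + r + e = s. The two quadratic forms that bound the factors are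
   then both [qf (T s) w], and the mean inequality gives 2 z <= 2 after division by this positive
   number. *)
pose e := (s - r) / 2.
have w0 : 0 < qf (T s) w.
  rewrite [s in T s]splitr -TD /qf mulmxA rdot_mulmx TH rdot_gt0 //.
  apply: contra (row_unitary_neq0 k Wu) => /eqP.
  move=> /(congr1 (mulmx^~ (T (t / 2 - s / 2)))).
  by rewrite mul0mx -!mulmxA !TD [t / 2 - _]addrC addNKr addNr T0 mulmx1 => ->.
have zw : z 0 k * qf (T s) w = rdot (w *m S (s / 2)) (w *m T e *m S (r / 2)).
  rewrite -rdotZl ?(mxOverP zr) //.
  have -> : z 0 k *: (w *m T s) = w *m S t *m T e.
    rewrite wS -scalemxAl -mulmxA TD; congr (_ *: (_ *m T _)).
    by rewrite /t /e -mulrDl addrC subrKA mulrDl -splitr.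
  rewrite [LHS]rdot_mulmx TH -[S (r / 2)]SH -rdot_mulmx -mulmxA SD ?divr_ge0 //.
  by rewrite -mulrDl addrC.
have := rdot_le_mean (w *m S (s / 2)) (w *m T e *m S (r / 2)).
rewrite -zw.
have qfS q u : 0 <= q -> rdot (u *m S (q / 2)) (u *m S (q / 2)) = qf (S q) u.
  move=> q0; rewrite -{2}[S (q / 2)]SH -rdot_mulmx -mulmxA.
  by rewrite SD ?divr_ge0 // -splitr.
rewrite !qfS // => h.
have {h} := le_trans h (lerD (les w) (ler (w *m T e))).
have -> : qf (T r) (w *m T e) = qf (T s) w.
  rewrite -qf_conj TH !TD; congr (qf (T _) w).
  by rewrite addrAC /e -splitr subrK.
by rewrite -mulr2n -[leRHS]mulr_natl ler_pM2l ?ltr0n // ger_pMl.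
Qed.

End LoewnerHeinz.

(** Bisection: both endpoints of an interval around [c] stay in [D] while its length is halved. *)
Lemma midpoint_dense (R : archiRealFieldType) (D : R -> Prop) (a b c : R) :
  (forall r s, D r -> D s -> D ((r + s) / 2)) -> D a -> D b -> a <= c <= b ->
  forall e, 0 < e -> exists2 t, D t & `|c - t| < e.
Proof.
move=> Dmid Da Db /andP[ac cb] e e0.
have bisect m : exists lo hi, [/\ D lo, D hi, lo <= c <= hi
    & hi - lo = (b - a) / 2 ^+ m].
  elim: m => [|m [lo [hi [Dlo Dhi /andP[loc chi] E]]]].
    by exists a, b; split=> //; [rewrite ac|rewrite expr0 divr1].
  have Dm := Dmid _ _ Dlo Dhi.
  have E2 : (hi - lo) / 2 = (b - a) / 2 ^+ m.+1.
    by rewrite E exprSr invfM mulrA.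
  have [cm|mc] := leP c ((lo + hi) / 2).
    by exists lo, ((lo + hi) / 2); split; rewrite ?loc -?E2 //; lra.
  by exists ((lo + hi) / 2), hi; split; rewrite ?(ltW mc) -?E2 //; lra.
have ab0 : 0 <= (b - a) / e.
  by rewrite divr_ge0 ?(ltW e0) // subr_ge0 (le_trans ac).
(* The number m of halvings exceeds (b - a) / e, and m < 2 ^ m makes the last interval shorter than
   [e]. *)
have [lo [hi [Dlo _ /andP[loc chi] E]]] := bisect (Num.bound ((b - a) / e)).
exists lo => //; rewrite ger0_norm ?subr_ge0 //.
apply: (@le_lt_trans _ _ (hi - lo)); first by rewrite lerB.
rewrite E ltr_pdivrMr ?exprn_gt0 // mulrC -ltr_pdivrMr //.
apply: lt_le_trans (archi_boundP ab0) _.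
by rewrite -natrX ler_nat ltnW // ltn_expl.
Qed.

(** * Real powers in an eigenbasis and the trace bound for matrices *)

Section RealPowers.
Context {R : realType} {n : nat}.
Implicit Types (U V : 'M[R[i]]_n) (l m : 'rV[R]_n) (v : 'rV[R[i]]_n).

Definition cdiag U l : 'M[R[i]]_n := udiag U (map_mx (real_complex R) l).

Definition powmx U l (t : R) : 'M[R[i]]_n :=
  cdiag U (map_mx (fun y => y `^ t) l).

(** The squared modulus, taken in [R] so that quadratic forms become real functions whose limits can
    be studied. *)
Definition nsq (z : R[i]) : R := complex.Re z ^+ 2 + complex.Im z ^+ 2.

Lemma map_real_complex_real l : map_mx (real_complex R) l \is a mxOver Num.real.
Proof. by apply/mxOverP => i j; rewrite mxE; apply/complex_realP; eexists. Qed.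

Lemma cdiag_hermitian U l : (cdiag U l)^t* = cdiag U l.
Proof. exact: udiag_hermitian (map_real_complex_real l). Qed.

Lemma qf_cdiag U l v : qf (cdiag U l) v =
  (\sum_k l 0 k * nsq ((v *m U^t*) 0 k))%:C.
Proof.
rewrite (qf_udiag U v (map_real_complex_real l)) rmorph_sum.
by apply: eq_bigr => k _; rewrite mxE rmorphM -add_Re2_Im2.
Qed.

Lemma qle_cdiag U l m : (forall k, l 0 k <= m 0 k) ->
  qle (cdiag U l) (cdiag U m).
Proof.
move=> lm; apply: qle_udiag => [||k]; try exact: map_real_complex_real.
by rewrite !mxE lecR.
Qed.

Lemma powmxM U l s t : U \is unitarymx ->
  (forall k, (l 0 k) `^ (s + t) = (l 0 k) `^ s * (l 0 k) `^ t) ->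
  powmx U l s *m powmx U l t = powmx U l (s + t).
Proof.
move=> Uu lD; apply: etrans (udiagM _ _ Uu) _; congr udiag.
by apply/rowP => k; rewrite !mxE lD rmorphM.
Qed.

Lemma powmx0 U l : U \is unitarymx -> powmx U l 0 = 1%:M.
Proof.
move=> Uu; rewrite -(udiag1 Uu); congr udiag.
by apply/rowP => k; rewrite !mxE powRr0.
Qed.

Lemma powmx1 U l : (forall k, 0 <= l 0 k) -> powmx U l 1 = cdiag U l.
Proof.
by move=> l0; congr cdiag; apply/rowP => k; rewrite mxE powRr1.
Qed.

Lemma powRr_continuous_at1 (y : R) : {for 1, continuous (powR y)}.
Proof.
rewrite /powR; have [_|y0] := eqVneq y 0.
  apply: (@near_cst_continuous _ _ 0).
  near=> t; have t0 : 0 < t by near: t; exact: lt_nbhsr.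
  by rewrite (negPf (lt0r_neq0 t0)).
apply: continuous_comp; first exact: mulrr_continuous.
exact: continuous_expR.
Unshelve. all: by end_near. Qed.

(** At a fixed vector the difference of the two forms is continuous in the exponent at 1, so if it
    were negative there it would be negative at all nearby exponents. *)
Lemma qle_powmx_closed U V l m :
  (forall e : R, 0 < e ->
    exists2 t, qle (powmx U l t) (powmx V m t) & `|1 - t| < e) ->
  qle (powmx U l 1) (powmx V m 1).
Proof.
move=> dense v; rewrite !qf_cdiag lecR leNgt; apply/negP => lt1.
pose f t := \sum_k (map_mx (fun y => y `^ t) m) 0 k * nsq ((v *m V^t*) 0 k)
  - \sum_k (map_mx (fun y => y `^ t) l) 0 k * nsq ((v *m U^t*) 0 k).
have fc : f t @[t --> (1 : R)] --> f 1.
  by apply: cvgB; apply: cvg_big => [|k _]; try exact: add_continuous;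
    under eq_fun do rewrite mxE; rewrite mxE; apply: cvgMl;
    exact: powRr_continuous_at1.
have f1 : f 1 < 0 by rewrite subr_lt0.
have [e /= e0 he] := cvgr_lt (f 1) fc 0 f1.
have [t lt te] := dense e e0.
have := he t te; rewrite /= subr_lt0 ltNge => /negP; apply.
by have := lt v; rewrite !qf_cdiag lecR.
Qed.

Lemma mxtrace_powmx U V l m p : U \is unitarymx -> V \is unitarymx ->
  (forall k, 0 <= l 0 k) -> (forall k, 0 < m 0 k) -> 1 <= p ->
  0 <= \tr (powmx U l p *m powmx V m (- p)) /\
  (~ qle (cdiag U l) (cdiag V m) ->
    1 <= \tr (powmx U l p *m powmx V m (- p))).
Proof.
move=> Uu Vu l0 m0 p1; have p0 : 0 <= p by rewrite (le_trans ler01).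
have SH t : (powmx U l t)^t* = powmx U l t by exact: cdiag_hermitian.
have TH t : (powmx V m t)^t* = powmx V m t by exact: cdiag_hermitian.
have SD s t : 0 <= s -> 0 <= t ->
    powmx U l s *m powmx U l t = powmx U l (s + t).
  move=> s0 t0; apply: powmxM => // k.
  (* For base 0 the addition law needs care when s + t = 0; nonnegativity then forces s = t = 0. *)
  have [st|st] := eqVneq (s + t) 0; last by rewrite powRD // (negPf st).
  have /andP[/eqP -> /eqP ->] : (s == 0) && (t == 0) by rewrite -paddr_eq0 ?st.
  by rewrite addr0 !powRr0 mulr1.
have TD s t : powmx V m s *m powmx V m t = powmx V m (s + t).
  apply: powmxM => // k; rewrite powRD //.
  by apply/implyP => _; rewrite lt0r_neq0.
have T0 := powmx0 m Vu.
have tr0 := mxtrace_ST_ge0 SH TH SD TD p0.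
(* The order of [R[i]] is total only on reals; the trace is real because it is nonnegative. *)
split=> // nle; rewrite real_leNgt ?real1 ?ger0_real //; apply/negP => tr1.
apply: nle; rewrite -(powmx1 U l0) -(powmx1 V (fun k => ltW (m0 k))).
apply: qle_powmx_closed => e e0.
(* Nonnegativity is carried along because the midpoint step needs it. The exponent 0 belongs to [D]
   since both powers are the identity, [p] by the trace bound, and 1 lies between them. *)
pose D t := 0 <= t /\ qle (powmx U l t) (powmx V m t).
have [||||t [_ lt] te] := @midpoint_dense R D 0 p 1 _ _ _ _ e e0; last first.
- by exists t.
- by rewrite ler01.
- by split; [exact: p0|exact: (qle_of_mxtrace SH TH SD TD T0 p0 tr1)].
- by split; [exact: lexx|rewrite (powmx0 l Uu) T0 => v; exact: lexx].
move=> r s [r0 ler] [s0 les]; split; first by rewrite divr_ge0 // addr_ge0.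
exact: (loewner_midpoint SH TH SD TD T0).
Qed.

End RealPowers.

(** * Quadratic forms in real coordinates and Gaussian integer vectors *)

Section RealForm.
Context {R : realType} {n : nat}.
Implicit Types (M : 'M[R[i]]_n) (x y : 'I_n -> R).

(** The real part of the sum of M_jk v_j conj(v_k) for v = x + i y. *)
Definition rform M x y : R := \sum_j \sum_k
  (complex.Re (M j k) * (x j * x k + y j * y k)
   - complex.Im (M j k) * (y j * x k - x j * y k)).

Lemma qf_rform M (v : 'rV[R[i]]_n) :
  qf M v =
  (rform M (fun j => complex.Re (v 0 j)) (fun j => complex.Im (v 0 j)))%:C.
Proof.
rewrite /qf /rdot -complexRe; congr (_%:C).
rewrite mxE raddf_sum.
rewrite /rform exchange_big; apply: eq_bigr => k _ /=.
rewrite !mxE mulr_suml raddf_sum; apply: eq_bigr => j _ /=.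
by case: (M j k) (v 0 j) (v 0 k) => [a b] [c d] [e f] /=; ring.
Qed.

Lemma rformZ M c x y :
  rform M (fun j => c * x j) (fun j => c * y j) = c ^+ 2 * rform M x y.
Proof.
rewrite /rform mulr_sumr; apply: eq_bigr => j _; rewrite mulr_sumr.
by apply: eq_bigr => k _; ring.
Qed.

Lemma cvg_rform M (f g : nat -> 'I_n -> R) x y :
  (forall j, f m j @[m --> \oo] --> x j) ->
  (forall j, g m j @[m --> \oo] --> y j) ->
  rform M (f m) (g m) @[m --> \oo] --> rform M x y.
Proof.
move=> fx gy; apply: cvg_big => [|j _]; first exact: add_continuous.
apply: cvg_big => [|k _]; first exact: add_continuous.
by apply: cvgB; apply: cvgMr; [apply: cvgD|apply: cvgB]; apply: cvgM.
Qed.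

Lemma cvg_floor_scaled (t : R) :
  (Num.floor (m.+1%:R * t))%:~R / m.+1%:R @[m --> \oo] --> t.
Proof.
have lim0 : t - harmonic m @[m --> \oo] --> t.
  rewrite -[X in _ --> X]subr0; apply: cvgB; first exact: cvg_cst.
  exact: cvg_harmonic.
apply: (@squeeze_cvgr _ _ _ _ _ (fun=> t) _ _ _ lim0); last exact: cvg_cst.
apply: nearW => m /=; have m0 : 0 < m.+1%:R :> R by rewrite ltr0n.
have /andP[f1 f2] := floor_itv (m.+1%:R * t).
rewrite ler_pdivrMr // [t * _]mulrC f1 andbT ler_pdivlMr //.
rewrite mulrBl mulVf ?gt_eqF //.
by rewrite lerBlDr mulrC; apply: ltW; rewrite -intrD1.
Qed.

(** Negativity is an open condition, so it survives rational approximation of [x] and [y] with a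
    common denominator [m.+1]; homogeneity of degree 2 then clears the denominator. *)
Lemma rform_lt0_int M x y : rform M x y < 0 ->
  exists f g : {ffun 'I_n -> int},
    rform M (fun j => (f j)%:~R) (fun j => (g j)%:~R) < 0.
Proof.
move=> lt0.
pose a (z : 'I_n -> R) m : {ffun 'I_n -> int} :=
  [ffun j => Num.floor (m.+1%:R * z j)].
pose s z m j : R := m.+1%:R^-1 * (a z m j)%:~R.
have sE z j : s z m j @[m --> \oo] --> z j.
  rewrite /s; under eq_fun do rewrite ffunE mulrC.
  exact: cvg_floor_scaled.
have [N _ hN] := cvgr_lt _ (cvg_rform (M := M) (sE x) (sE y)) 0 lt0.
exists (a x N), (a y N).
by have := hN N (leqnn N); rewrite /= rformZ pmulr_rlt0 // exprn_gt0 // invr_gt0.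
Qed.

End RealForm.

(** * Measurability of the failure of semipositivity *)

Section MeasurablePsd.
Context {R : realType} {n : nat} {d : measure_display} {T : measurableType d}.
Variable M : T -> 'M[R[i]]_n.
Hypothesis mRe : forall j k, measurable_fun setT (fun w => complex.Re (M w j k)).
Hypothesis mIm : forall j k, measurable_fun setT (fun w => complex.Im (M w j k)).

Lemma measurable_qf_lt0 : measurable [set w | exists v, qf (M w) v < 0].
Proof.
pose IV := ({ffun 'I_n -> int} * {ffun 'I_n -> int})%type.
rewrite (_ : [set w | _] = \bigcup_(z : IV) [set w | rform (M w)
    (fun j => (z.1 j)%:~R) (fun j => (z.2 j)%:~R) < 0]).
  apply: countable_bigcupT_measurable => [|z]; first exact: countableP.
  rewrite -[X in measurable X]setTI.
  have mf : measurable_fun setT (fun w => rform (M w)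
      (fun j => (z.1 j)%:~R) (fun j => (z.2 j)%:~R)).
    apply: measurable_sum => j; apply: measurable_sum => k.
    by apply: measurable_funB; apply: measurable_funM => //;
      exact: measurable_cst.
  have := measurable_fun_ltr mf (measurable_cst (0 : R)).
  by move=> /(_ measurableT [set true] I).
apply/seteqP; split => [w [v]|w [[f g] _ /= h]] /=.
  rewrite qf_rform ltcR => /rform_lt0_int[f [g h]].
  by exists (f, g).
exists (\row_j ((f j)%:~R +i* (g j)%:~R)); rewrite qf_rform ltcR.
by congr (_ < 0): h; congr rform; apply/funext => j; rewrite mxE.
Qed.

End MeasurablePsd.

(** * Transfer from tensors to matrices and the pointwise trace bound *)

Section Unfolding.
Context {R : realType} {N : nat} {I : 'I_N -> nat}.
Implicit Types X Y : tensor R I.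

Let spec X := spectralmx (unfold_tensor X).
Let eigs X : 'rV[R]_#|midx I| :=
  map_mx (@complex.Re R) (spectral_diag (unfold_tensor X)).

Lemma unfold_tensor_adjoint X : thermitian X ->
  (unfold_tensor X)^t* = unfold_tensor X.
Proof.
by move=> hX; apply/matrixP => a b; rewrite !mxE -[in RHS]hX ffunE.
Qed.

Lemma unfold_tensorB X Y :
  unfold_tensor (X - Y) = unfold_tensor X - unfold_tensor Y.
Proof. by apply/matrixP => a b; rewrite !mxE !ffunE. Qed.

Lemma thermitianB X Y : thermitian X -> thermitian Y -> thermitian (X - Y).
Proof.
move=> hX hY; apply/ffunP => -[i j].
by rewrite -[in RHS]hX -[in RHS]hY !ffunE /= rmorphB.
Qed.

Lemma unfold_tensor_cdiag X : thermitian X ->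
  unfold_tensor X = cdiag (spec X) (eigs X).
Proof.
move=> /unfold_tensor_adjoint /hermitian_udiag[XE lr].
rewrite {1}XE; congr udiag; apply/rowP => k.
by rewrite !mxE RRe_real //; exact: (mxOverP lr).
Qed.

Lemma unfold_tfun (f : R -> R) X :
  unfold_tensor (tfun f X) = cdiag (spec X) (map_mx f (eigs X)).
Proof.
rewrite /tfun fold_tensorK.
apply: etrans (invmx_udiag _ (spectral_unitarymx _)) _.
by congr udiag; apply/rowP => k; rewrite !mxE.
Qed.

Lemma thermitian_tfun (f : R -> R) X : thermitian (tfun f X).
Proof.
have h := cdiag_hermitian (spec X) (map_mx f (eigs X)).
rewrite -unfold_tfun in h.
apply/ffunP => -[i j]; rewrite ffunE /=.
by have /matrixP/(_ (enum_rank i) (enum_rank j)) := h; rewrite !mxE !enum_rankK.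
Qed.

Lemma unfold_tpow X t : unfold_tensor (tpow X t) = powmx (spec X) (eigs X) t.
Proof. exact: unfold_tfun. Qed.

(** [tpow] diagonalizes [tabs X] afresh, possibly in another eigenbasis; by [tfunE] the one chosen
    for [X] serves as well. *)
Lemma unfold_tpow_tabs X t : thermitian X ->
  unfold_tensor (tpow (tabs X) t) =
  powmx (spec X) (map_mx (fun y => `|y|) (eigs X)) t.
Proof.
move=> hX; have Uu : spec X \is unitarymx := spectral_unitarymx _.
pose l : 'rV[R[i]]_#|midx I| :=
  map_mx (real_complex R) (map_mx (fun y => `|y|) (eigs X)).
have XE : unfold_tensor (tabs X) = invmx (spec X) *m diag_mx l *m spec X.
  by rewrite unfold_tfun; apply: esym; exact: invmx_udiag.
rewrite /tpow (tfunE _ (thermitian_tfun _ _) (unitarymx_unit Uu) XE).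
rewrite fold_tensorK; apply: etrans (invmx_udiag _ Uu) _.
by congr udiag; apply/rowP => k; rewrite !mxE.
Qed.

Lemma teigenvalueP X a : teigenvalue X a <->
  exists2 w : 'cV_#|midx I|, w != 0 & unfold_tensor X *m w = a *: w.
Proof.
split=> -[v v0 Xv].
  exists (\col_k v (enum_val k)).
    apply: contra v0 => /eqP /colP v0; apply/eqP/ffunP => i.
    by have := v0 (enum_rank i); rewrite !mxE enum_rankK ffunE.
  apply/colP => k; rewrite !mxE -Xv.
  rewrite (reindex _ (onW_bij _ (@enum_val_bij (midx I)))) /=.
  by apply: eq_bigr => j _; rewrite !mxE.
exists [ffun i => v (enum_rank i) 0].
  apply: contra v0 => /eqP /ffunP v0; apply/eqP/colP => k.
  by have := v0 (enum_val k); rewrite !ffunE enum_valK mxE.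
move=> i; rewrite ffunE; have /colP/(_ (enum_rank i)) := Xv.
rewrite !mxE => <-; rewrite (reindex _ (onW_bij _ (@enum_val_bij (midx I)))) /=.
by apply: eq_bigr => j _; rewrite !mxE ffunE enum_valK enum_rankK.
Qed.

Lemma teigenvalue_eigs X k : thermitian X -> teigenvalue X (eigs X 0 k)%:C.
Proof.
move=> hX; have Uu : spec X \is unitarymx := spectral_unitarymx _.
apply/teigenvalueP; exists (col k ((spec X)^t*)).
  exact: col_unitary_neq0.
rewrite unfold_tensor_cdiag // [LHS](udiag_col _ k Uu); congr (_ *: _).
by rewrite mxE.
Qed.

(** Forward, the form is a combination of the eigenvalues with nonnegative weights; backward is
    [eigenvalue_ge0]. *)
Lemma tspdP X : thermitian X ->
  tspd X <-> forall v, 0 <= qf (unfold_tensor X) v.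
Proof.
move=> hX; split=> [[_ X0] v|X0].
  rewrite unfold_tensor_cdiag // qf_cdiag ler0c sumr_ge0 // => k _.
  rewrite mulr_ge0 ?addr_ge0 ?sqr_ge0 // -ler0c.
  exact/X0/teigenvalue_eigs.
split=> // a /teigenvalueP[w w0 Xw].
exact: eigenvalue_ge0 (unfold_tensor_adjoint hX) X0 w0 Xw.
Qed.

Lemma tleP X Y : thermitian X -> thermitian Y ->
  tle X Y <-> qle (unfold_tensor X) (unfold_tensor Y).
Proof.
move=> hX hY; rewrite /tle tspdP; last exact: thermitianB.
rewrite unfold_tensorB; split=> h v; have := h v;
  by rewrite qfD qfN subr_ge0.
Qed.

Lemma ttrace_einstein X Y :
  ttrace (einstein X Y) = \tr (unfold_tensor X *m unfold_tensor Y).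
Proof.
rewrite /ttrace /mxtrace (reindex _ (onW_bij _ (@enum_val_bij (midx I)))) /=.
apply: eq_bigr => a _; rewrite ffunE mxE.
rewrite (reindex _ (onW_bij _ (@enum_val_bij (midx I)))) /=.
by apply: eq_bigr => b _; rewrite !mxE.
Qed.

(** The Markov-type bound at a single outcome: the trace dominates the indicator of the event. *)
Lemma ttrace_tabs_tpow A X p : tpd A -> thermitian X -> 1 <= p ->
  0 <= ttrace (einstein (tpow (tabs X) p) (tpow A (- p))) /\
  (~ tle X A -> 1 <= ttrace (einstein (tpow (tabs X) p) (tpow A (- p)))).
Proof.
move=> [hA A0] hX p1.
have trE : ttrace (einstein (tpow (tabs X) p) (tpow A (- p))) =
    \tr (powmx (spec X) (map_mx (fun y => `|y|) (eigs X)) p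
          *m powmx (spec A) (eigs A) (- p)).
  apply: etrans (ttrace_einstein _ _) _.
  congr (\tr (_ *m _)); first exact: unfold_tpow_tabs.
  exact: unfold_tpow.
have a0 k : 0 < eigs A 0 k by rewrite -ltcR; exact/A0/teigenvalue_eigs.
have x0 k : 0 <= map_mx (fun y => `|y|) (eigs X) 0 k by rewrite mxE.
have Uu : spec X \is unitarymx := spectral_unitarymx _.
have Vu : spec A \is unitarymx := spectral_unitarymx _.
rewrite trE; have [tr0 tr1] := mxtrace_powmx Uu Vu x0 a0 p1.
split; first exact: tr0.
(* The matrix bound concerns |X|. It passes to [X] because X <= |X|, eigenvalue by eigenvalue in a
   common basis. *)
move=> nle; apply: tr1 => le; apply/nle/(tleP hX hA) => v.
have := le v; rewrite -(unfold_tensor_cdiag hA); apply: le_trans.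
rewrite (unfold_tensor_cdiag hX).
by apply: qle_cdiag => k; rewrite [leRHS]mxE ler_norm.
Qed.

End Unfolding.

(** * Exchange of expectation and trace *)

Lemma Rintegral_lincomb {R : realType} {d : measure_display}
    {T : measurableType d} (mu : {measure set T -> \bar R})
    (J : Type) (s : seq J) (c : J -> R) (f : J -> T -> R) :
  (forall j, mu.-integrable setT (EFin \o f j)) ->
  mu.-integrable setT (EFin \o (fun w => \sum_(j <- s) c j * f j w)) /\
  (\int[mu]_w (\sum_(j <- s) c j * f j w) =
    \sum_(j <- s) c j * \int[mu]_w f j w)%R.
Proof.
move=> fi; elim: s => [|j s [IHi IHs]].
  split; first by under eq_fun do rewrite big_nil; exact: integrable0.
  under eq_Rintegral do rewrite big_nil.
  by rewrite big_nil Rintegral_cst // mul0r.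
have ji : mu.-integrable setT (EFin \o (fun w => c j * f j w)).
  exact: (integrableZl measurableT (c j) (fi j)).
split.
  by under eq_fun do rewrite big_cons; exact: (integrableD measurableT ji IHi).
under eq_Rintegral do rewrite big_cons.
by rewrite RintegralD // big_cons IHs RintegralZl.
Qed.

(** Arranged as a real linear combination of the two parts of [a], the random factor, with
    coefficients from [b]. *)
Lemma Re_mulc {R : realType} (a b : R[i]) : complex.Re (a * b) =
  complex.Re b * complex.Re a + - complex.Im b * complex.Im a.
Proof. by case: a b => [a b] [c e] /=; ring. Qed.

Lemma Im_mulc {R : realType} (a b : R[i]) : complex.Im (a * b) =
  complex.Im b * complex.Re a + complex.Re b * complex.Im a.
Proof. by case: a b => [a b] [c e] /=; ring. Qed.

Section Expectation.
Context {R : realType} {d : measure_display} {Omega : measurableType d}.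
Variables (P : probability Omega R) (N : nat) (I : 'I_N -> nat).
Implicit Types (Y : Omega -> tensor R I) (B : tensor R I).

Lemma ttrace_einstein_pair X B : ttrace (einstein X B) =
  \sum_(ij : midx I * midx I) X ij * B (ij.2, ij.1).
Proof.
transitivity (\sum_i \sum_j X (i, j) * B (j, i)).
  by apply: eq_bigr => i _; rewrite ffunE.
by rewrite pair_bigA; apply: eq_bigr => -[i j] _.
Qed.

Lemma ttrace_texpectation Y B : has_texpectation P Y ->
  let F w := ttrace (einstein (Y w) B) in
  [/\ P.-integrable setT (EFin \o (fun w => complex.Re (F w))),
      complex.Re (ttrace (einstein (texpectation P Y) B)) =
        \int[P]_w complex.Re (F w) &
      complex.Im (ttrace (einstein (texpectation P Y) B)) =
        \int[P]_w complex.Im (F w)].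
Proof.
move=> YE F; pose J := (midx I * midx I)%type.
(* The flag [true] selects the real part of an entry of [Y] and [false] its imaginary part; [c] and
   [e] collect the coefficients for the real and the imaginary part of the trace. *)
pose c (q : bool * J) := let z := B (q.2.2, q.2.1) in
  if q.1 then complex.Re z else - complex.Im z.
pose e (q : bool * J) := let z := B (q.2.2, q.2.1) in
  if q.1 then complex.Im z else complex.Re z.
pose f (q : bool * J) w :=
  if q.1 then complex.Re (Y w q.2) else complex.Im (Y w q.2).
have fi q : P.-integrable setT (EFin \o f q).
  by case: q => -[] [i j]; have [] := YE i j.
have sum2 (G : bool * J -> R) :
    \sum_q G q = \sum_ij (G (true, ij) + G (false, ij)).
  transitivity (\sum_b \sum_ij G (b, ij)).
    by rewrite pair_bigA; apply: eq_bigr => -[b ij] _.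
  by rewrite exchange_big; apply: eq_bigr => ij _; rewrite big_bool.
have ReF w : complex.Re (F w) = \sum_q c q * f q w.
  rewrite /F ttrace_einstein_pair raddf_sum sum2.
  by apply: eq_bigr => ij _; exact: Re_mulc.
have ImF w : complex.Im (F w) = \sum_q e q * f q w.
  rewrite /F ttrace_einstein_pair raddf_sum sum2.
  by apply: eq_bigr => ij _; exact: Im_mulc.
have EY ij : texpectation P Y ij =
    (\int[P]_w f (true, ij) w) +i* (\int[P]_w f (false, ij) w).
  by case: ij => i j; rewrite ffunE unlock.
have [ci cs] := Rintegral_lincomb (mu := P) (index_enum _) c fi.
have [_ es] := Rintegral_lincomb (mu := P) (index_enum _) e fi.
split.
- by under eq_fun do rewrite ReF.
- under eq_Rintegral do rewrite ReF.
  rewrite cs sum2 ttrace_einstein_pair raddf_sum; apply: eq_bigr => ij _.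
  by rewrite EY; exact: Re_mulc.
- under eq_Rintegral do rewrite ImF.
  rewrite es sum2 ttrace_einstein_pair raddf_sum; apply: eq_bigr => ij _.
  by rewrite EY; exact: Im_mulc.
Qed.

End Expectation.

(** * Measurability of the event *)

Section Event.
Context {R : realType} {d : measure_display} {Omega : measurableType d}.
Variables (N : nat) (I : 'I_N -> nat).
Variables (A : tensor R I) (X : Omega -> tensor R I).

(** Values of [qf] are real, so the order fails exactly when the form of A - X is negative at some
    vector. *)
Lemma measurable_not_tle : thermitian A -> random_hermitian X ->
  measurable [set w | ~ tle (X w) A].
Proof.
move=> hA [mX hX].
rewrite (_ : [set w | _] =
    [set w | exists v, qf (unfold_tensor A - unfold_tensor (X w)) v < 0]).
  apply: measurable_qf_lt0 => j k.
    under eq_fun do rewrite !mxE raddfB.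
    apply: measurable_funB; first exact: measurable_cst.
    by have [] := mX (enum_val j) (enum_val k).
  under eq_fun do rewrite !mxE raddfB.
  apply: measurable_funB; first exact: measurable_cst.
  by have [] := mX (enum_val j) (enum_val k).
apply/seteqP; split => w /=.
  move=> /(tleP (hX w) hA)/existsNP[v /negP nle]; exists v.
  by rewrite qfD qfN subr_lt0 real_ltNge ?qf_real.
move=> [v]; rewrite qfD qfN subr_lt0 => lt /(tleP (hX w) hA)/(_ v) le.
by have := lt_le_trans lt le; rewrite ltxx.
Qed.

End Event.

(** * Integration of the pointwise bound *)

Unset Implicit Arguments.
Set Strict Implicit.

Theorem theorem3 (R : realType) (d : measure_display)
    (Omega : measurableType d) (P : probability Omega R)
    (N : nat) (I : 'I_N -> nat)
    (A : tensor R I) (X : Omega -> tensor R I) (p : R)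
    (A_pd : tpd A)
    (X_herm : random_hermitian X)
    (p_ge1 : 1 <= p)
    (EX : has_texpectation P (fun w => tpow (tabs (X w)) p)) :
  (fine (P [set w | ~ tle (X w) A]%classic))%:C <=
  ttrace (einstein (texpectation P (fun w => tpow (tabs (X w)) p))
                   (tpow A (- p))).
Proof.
have hA := A_pd.1; have hX := X_herm.2.
have mB := measurable_not_tle hA X_herm.
set B := [set w | _]%classic in mB *.
have [iF ReE ImE] := ttrace_texpectation (tpow A (- p)) EX.
have F0 w := (ttrace_tabs_tpow A_pd (hX w) p_ge1).1.
have F1 w := (ttrace_tabs_tpow A_pd (hX w) p_ge1).2.
(* A complex inequality means equal imaginary parts and ordered real parts. The imaginary part
   integrates to 0 because the trace is nonnegative, hence real, at every outcome. *)
rewrite lecE ImE ReE /=; apply/andP; split.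
  under eq_Rintegral do rewrite (ger0_Im (F0 _)).
  by rewrite Rintegral_cst // mul0r.
have -> : fine (P B) = (\int[P]_w \1_B w)%R.
  by rewrite /Rintegral integral_indic // setIT.
(* Outcome by outcome, the indicator is at most the trace: [F1] on the event, [F0] off it. *)
apply: le_Rintegral => //; first exact: integrable_indic.
move=> w _; rewrite indicE; have [wB|_] := boolP (w \in B).
  by have := F1 w (set_mem wB); rewrite lecE => /andP[].
by have := F0 w; rewrite lecE => /andP[].
Qed.
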